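(* Let $\mathcal{A}=\mathbb{C}\langle s_1,\dots,s_r\rangle$ and let $\varphi:\mathcal{A}\to\mathbb{C}$ be the unital linear functional defined on monomials by $\varphi(s_{i_1}\cdots s_{i_m})=\#\,\mathcal{NC}_2^{[i]}(m)$, $i=(i_1,\dots,i_m)$. Then for all $m\ge1$, all $i_1,\dots,i_m\in\{1,\dots,r\}$ with $i_1\ne i_2,\ i_2\ne i_3,\ \dots,\ i_{m-1}\ne i_m$, and all polynomials $p_1,\dots,p_m$ in one variable such that $\varphi(p_k(s_{i_k}))=0$ for all $k=1,\dots,m$, we have $$\varphi\left(p_1(s_{i_1})\,p_2(s_{i_2})\cdots p_m(s_{i_m})\right)=0 .$$
   Context: $\mathbb{C}\langle s_1,\dots,s_r\rangle$ is the free unital algebra over $\mathbb{C}$ generated by the non-commuting variables $s_1,\dots,s_r$ (linear basis: the monomials $s_{i_1}\cdots s_{i_m}$, $m\ge0$; multiplication by concatenation). Unital means $\varphi(1)=1$. A pairing of $\{1,\dots,m\}$ is a decomposition into disjoint two-element subsets; it is non-crossing if there are no two pairs $(p,s)$, $(q,t)$ of it with $p<q<s<t$; it respects $i=(i_1,\dots,i_m)$ if $i_p=i_q$ for every pair $(p,q)$. $\mathcal{NC}_2^{[i]}(m)$ is the set of non-crossing pairings of $\{1,\dots,m\}$ that respect $i$ (empty for $m$ odd). *)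

(* Defs.v *)
From HB Require Import structures.
From mathcomp Require Import all_boot all_order all_algebra.
From mathcomp Require Import finmap.
From mathcomp Require Export reals complex monalg.

Set Implicit Arguments.
Unset Strict Implicit.
Unset Printing Implicit Defensive.

Import GRing.Theory.
Local Open Scope ring_scope.

Section Pairings.
Variables (I : eqType) (m : nat).
Implicit Types (P : {set {set 'I_m}}) (i : m.-tuple I).

Definition pairing P : bool :=
  partition P [set: 'I_m] && [forall B in P, #|B| == 2%N].

Definition noncrossing P : bool :=
  ~~ [exists p : 'I_m, exists q : 'I_m, exists s : 'I_m, exists t : 'I_m,
        [&& (p < q)%N, (q < s)%N, (s < t)%N,
            [set p; s] \in P & [set q; t] \in P]].

Definition respects i P : bool :=
  [forall p : 'I_m, forall q : 'I_m,
     ([set p; q] \in P) ==> (tnth i p == tnth i q)].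

Definition NC2 i : {set {set {set 'I_m}}} :=
  [set P | [&& pairing P, noncrossing P & respects i P]].

End Pairings.

(* K<s_0, ..., s_{r-1}>: the monoid algebra of the free monoid on 'I_r, whose
   basis elements are the words << w >>, w : {fmonom 'I_r}.  It is an alias of the
   type from monalg because the algType instance of the latter is restricted to
   commutative monoids. *)
Definition free_alg (K : comNzRingType) (r : nat) : Type :=
  {malg K[{fmonom 'I_r}]}.

Section FreeAlgebra.
Variables (K : comNzRingType) (r : nat).

HB.instance Definition _ := GRing.Lalgebra.on (free_alg K r).

Fact free_alg_scalerAr (a : K) (x y : free_alg K r) :
  a *: (x * y) = x * (a *: y).
Proof.
apply/malgP => w; rewrite mcoeffZ mcoeffMl.
rewrite (mcoeffMlw w (fsubset_refl _) (msuppZ_le a y)) mulr_sumr.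
apply: eq_bigr => u _; rewrite mulr_sumr; apply: eq_bigr => v _.
by rewrite mcoeffZ mulrnAr mulrCA.
Qed.

HB.instance Definition _ :=
  GRing.Lalgebra_isAlgebra.Build K (free_alg K r) free_alg_scalerAr.

Definition gen (i : 'I_r) : free_alg K r := << fmu i >>.

(* The coercion {fmonom 'I_r} >-> seq 'I_r turns a word w into its list of
   indices, and in_tuple w into the corresponding (size w).-tuple. *)
Definition phi (a : free_alg K r) : K :=
  \sum_(w <- msupp a) a@_w * #|NC2 (in_tuple w)|%:R.

Let h (w : {fmonom 'I_r}) : K := #|NC2 (in_tuple w)|%:R.

Let phiE (a : free_alg K r) : phi a = mmap idfun h a.
Proof. by []. Qed.

Fact phi_linear : scalar phi.
Proof.
move=> c x y; rewrite !phiE mmapD; congr (_ + _).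
rewrite (mmapEw (msuppZ_le c x)) mmapE mulr_sumr.
by apply: eq_bigr => w _; rewrite mcoeffZ mulrA.
Qed.

HB.instance Definition _ :=
  GRing.isLinear.Build K (free_alg K r) K _ phi phi_linear.

Lemma prod_gen (s : seq 'I_r) :
  \prod_(j <- s) gen j = << FMonom s >> :> free_alg K r.
Proof.
elim: s => [|j s IHs].
  suff -> : FMonom [::] = mone :> {fmonom 'I_r} by rewrite big_nil.
  by apply: val_inj; rewrite /= fm1.
rewrite big_cons IHs [LHS]fgmulUU mulr1; congr mkmalgU.
by apply: val_inj; rewrite /= fmM fmU.
Qed.

Lemma phi_monomial (m : nat) (i : m.-tuple 'I_r) :
  phi (\prod_(k < m) gen (tnth i k)) = #|NC2 i|%:R.
Proof.
rewrite -(big_tuple _ _ i xpredT) prod_gen phiE mmapU mul1r /h /=.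
case: i => s sz_s; have Dm := eqP sz_s; subst m.
by congr (#|NC2 _|%:R); apply: val_inj.
Qed.

Lemma phi1 : phi 1 = 1.
Proof.
have := phi_monomial [tuple]; rewrite big_ord0 => ->.
rewrite (_ : NC2 _ = [set set0]) ?cards1 //; apply/setP => P; rewrite !inE.
apply/idP/eqP => [/and3P [/andP [/and3P [_ _ P_n0] _] _ _]|->].
  apply/setP => B; rewrite inE; apply: contraNF P_n0.
  by rewrite (_ : B = set0) //; apply/setP => - [].
apply/and3P; split.
- apply/andP; split; last by apply/forall_inP => B; rewrite inE.
  rewrite /partition /trivIset /cover !big_set0 cards0 inE eqxx andbT.
  by apply/eqP/setP => - [].
- by apply/existsPn => - [].
- by apply/forallP => - [].
Qed.

End FreeAlgebra.

(* Main.v *)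
From HB Require Import structures.
From mathcomp Require Import zify.
Require Import Defs.
From mathcomp Require Import all_boot all_order all_algebra.
Set Implicit Arguments.
Unset Strict Implicit.
Unset Printing Implicit Defensive.

Import GRing.Theory.
Local Open Scope ring_scope.

(** The functional phi is the vacuum state of a free semicircular family.  On
    the full Fock space with orthonormal basis the words e_st, put
    s_a = l_a + l_a^*, where l_a adds the letter a at one end of a word and
    l_a^* removes it there, or annihilates the word if it does not end in a.
    Reading a monomial letter by letter, each letter is thus either pushed on a
    stack or cancels an equal letter on top of it, and the vacuum coefficient
    counts the ways to come back to the empty stack.

    These ways are the non-crossing pairings (card_NC2): the pushed letters are
    the smaller elements of the pairs, and non-crossing means that a letter
    which closes a pair closes the most recently opened of the pairs still open.
    The proof runs through the pairings of the positions not yet cancelled; as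
    these positions stay inside one fixed ordinal type, deleting a pair needs no
    renumbering.

    Write psi st x for the vacuum coefficient when x is read from the stack st,
    so that phi = psi [::].  If a is not on top of st, then p(s_a) replaces st
    by a combination of the stacks a^n st, with coefficients c_n that depend on
    p alone (psi_horner); the c_n are the coordinates of p in the Chebyshev
    polynomials of the second kind, rescaled to be monic.  For st = [::] only
    n = 0 contributes to phi (p(s_a)), so c_0 = phi (p(s_a)), and a centred
    p(s_a) pushes at least one letter a.  In an alternating product every factor then meets a stack
    whose top is the previous index, hence again only pushes, and the stack can
    never be emptied (psi_alternating). *)

(** * Stack readings of a word *)

(** The coefficient of the empty word in e_st s_(w_1) ... s_(w_n), with the
    operators s_a = l_a + l_a^* acting from the right. *)
Fixpoint stack_count (I : eqType) (w st : seq I) : nat :=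
  if w is a :: w' then
    (stack_count w' (a :: st)
     + (if st is b :: st' then (b == a) * stack_count w' st' else 0))%N
  else nilp st.

(** * Non-crossing pairings are stack readings *)

Section StackPairings.
Variables (I : eqType) (m : nat) (i : m.-tuple I).
Implicit Types (P : {set {set 'I_m}}) (st : seq 'I_m) (k : nat).

Definition remaining st k : {set 'I_m} := [set x | (x \in st) || (k <= x)%N].

(** The ways to complete the pairing when positions below k have been read and
    those in st are still open: an open position has to be closed by a later
    one, so no pair lies inside st. *)
Definition stack_pairings st k : {set {set {set 'I_m}}} :=
  [set P | [&& partition P (remaining st k), [forall B in P, #|B| == 2%N],
               noncrossing P, respects i P
             & [forall B in P, ~~ (B \subset st)]]].

Lemma noncrossingP P :
  reflect (forall p q s t : 'I_m, (p < q)%N -> (q < s)%N -> (s < t)%N ->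
             [set p; s] \in P -> [set q; t] \notin P)
          (noncrossing P).
Proof.
apply: (iffP idP) => [ncP p q s t pq qs st Pps|ncP].
  apply: contra ncP => Pqt.
  apply/existsP; exists p; apply/existsP; exists q; apply/existsP; exists s.
  by apply/existsP; exists t; rewrite pq qs st Pps.
apply/existsP => -[p /existsP[q /existsP[s /existsP[t /and5P[pq qs st Pps]]]]].
by apply/negP; exact: ncP st Pps.
Qed.

Lemma respectsP P :
  reflect (forall p q, [set p; q] \in P -> tnth i p = tnth i q) (respects i P).
Proof.
apply: (iffP forallP) => [rP p q Ppq|rP p].
  by have /forallP/(_ q)/implyP/(_ Ppq)/eqP := rP p.
by apply/forallP => q; apply/implyP => /rP/eqP.
Qed.

Lemma pairing_partner P D (x : 'I_m) : partition P D -> [forall B in P, #|B| == 2%N] ->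
  x \in D -> exists2 y, y != x & [set x; y] \in P.
Proof.
move=> Ppart /forall_inP P2 Dx.
have covx : x \in cover P by rewrite (cover_partition Ppart).
have PB := pblock_mem covx; move: covx; rewrite -mem_pblock.
have /cards2P[a [b [ab eB]]] := P2 _ PB; rewrite eB in PB *.
rewrite !inE => /orP[] /eqP->; first by exists b; rewrite // eq_sym.
by exists a; rewrite // setUC.
Qed.

Lemma stack_pairings_end st : uniq st ->
  #|stack_pairings st m| = nilp st.
Proof.
have remaining_end : remaining st m = [set x in st].
  by apply/setP => x; rewrite !inE leqNgt ltn_ord orbF.
case: st remaining_end => [|j st] remaining_end _.
  rewrite (_ : stack_pairings _ _ = [set set0]) ?cards1 //.
  apply/setP => P; rewrite !inE remaining_end.
  rewrite (_ : [set x in _] = set0) ?partition_set0; last exact/setP.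
  case: eqP => //= ->; apply/and4P; split.
  - by apply/forall_inP => B; rewrite inE.
  - by apply/noncrossingP => p q s t _ _ _; rewrite inE.
  - by apply/respectsP => p q; rewrite inE.
  - by apply/forall_inP => B; rewrite inE.
apply/eqP; rewrite cards_eq0; apply/eqP/setP => P; rewrite !inE remaining_end.
apply/negP => /and5P[Ppart P2 _ _ /forall_inP Pst].
have [|y _ Py] := pairing_partner Ppart P2 (x := j); first by rewrite !inE eqxx.
have /subsetP sub := partitionS Ppart Py.
by case/negP: (Pst _ Py); apply/subsetP => x /sub; rewrite inE.
Qed.

Definition closing_pairings st (k : 'I_m) : {set {set {set 'I_m}}} :=
  [set P in stack_pairings st k | [exists j in st, [set j; k] \in P]].

(** The cases are that position k opens or closes a pair.  If it opens one, it
    passes from the positions not yet read to the stack, which leaves the set of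
    remaining positions unchanged. *)
Lemma stack_pairings_split st (k : 'I_m) : (forall x, x \in st -> (x < k)%N) ->
  #|stack_pairings st k|
    = (#|stack_pairings (k :: st) k.+1| + #|closing_pairings st k|)%N.
Proof.
move=> st_k.
pose closing := [set P : {set {set 'I_m}} | [exists j in st, [set j; k] \in P]].
rewrite -(cardsID closing) addnC; congr (_ + _)%N; last first.
  by congr #|pred_of_set _|; apply/setP => P; rewrite !inE.
congr #|pred_of_set _|; apply/setP => P; rewrite !inE.
have -> : remaining (k :: st) k.+1 = remaining st k.
  apply/setP => x; rewrite !inE (leq_eqVlt k) (inj_eq val_inj) eq_sym.
  by case: eqP; case: (x \in st).
case Ppart: (partition _ _) => /=; last by rewrite andbF.
case P2: [forall B in P, _] => /=; last by rewrite andbF.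
case: (noncrossing P) => /=; last by rewrite andbF.
case: (respects i P) => /=; last by rewrite andbF.
apply/andP/forall_inP => [[noj /forall_inP Pst] B PB|Pst].
  apply/negP => /subsetP Bst.
  move/forall_inP: P2 => /(_ _ PB)/cards2P[a [b [ab eB]]]; subst B.
  have /Bst := set21 a b; have /Bst := set22 a b; rewrite !inE.
  case/predU1P => [eb|bst]; case/predU1P => [ea|ast].
  - by rewrite ea eb eqxx in ab.
  - by case/exists_inP: noj; exists a => //; rewrite -eb.
  - by case/exists_inP: noj; exists b => //; rewrite -ea setUC.
  - by case/negP: (Pst _ PB); apply/subsetP => x /set2P[] ->.
split.
  apply/exists_inP => -[j jst Pj]; case/negP: (Pst _ Pj).
  by apply/subsetP => x /set2P[] ->; rewrite !inE ?jst ?orbT ?eqxx.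
apply/forall_inP => B PB; apply: contra (Pst _ PB) => /subsetP sub.
by apply/subsetP => x /sub; rewrite inE => ->; rewrite orbT.
Qed.

(** Only the top j of the stack can be closed, and a pair formed by the top and
    the next position crosses nothing: no remaining position lies between them.
    Deleting or adding that pair is therefore a bijection. *)
Lemma closing_pairings_cons j st (k : 'I_m) : path gtn k (map val (j :: st)) ->
  #|closing_pairings (j :: st) k|
    = ((tnth i j == tnth i k) * #|stack_pairings st k.+1|)%N.
Proof.
move=> /= /andP[/= jk]; rewrite (path_sortedE (rev_trans ltn_trans)) all_map.
case/andP=> /allP /= st_j _.
have jst : j \notin st by apply/negP => /st_j /=; rewrite ltnn.
have njk : j != k by rewrite neq_ltn jk.
have kst : k \notin st by apply/negP => /st_j /= ; lia.
have remainingE : remaining (j :: st) k = [set j; k] :|: remaining st k.+1.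
  apply/setP => x; rewrite !inE (leq_eqVlt k) (inj_eq val_inj) (eq_sym k).
  by do !case: (_ == _); case: (_ \in _).
have disj : [disjoint [set j; k] & remaining st k.+1].
  rewrite disjoints_subset; apply/subsetP => x /set2P[] ->; rewrite !inE.
    by rewrite (negbTE jst) /= -leqNgt; lia.
  by rewrite (negbTE kst) /= ltnn.
(* The block of k must meet the stack in its top: the pair of a stack element
   below the top would cross the pair that later closes the top. *)
have closeE P : P \in closing_pairings (j :: st) k -> [set j; k] \in P.
  rewrite !inE => /andP[/and5P[Ppart P2 /noncrossingP ncP _ /forall_inP Pst]].
  case/exists_inP=> x; rewrite inE => /predU1P[-> //|xst] Pxk.
  have [|y yj Py] := pairing_partner Ppart P2 (x := j); first by rewrite !inE eqxx.
  have xj : (x < j)%N := st_j _ xst.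
  have [yk|yk] := eqVneq y k; first by rewrite -yk.
  have /subsetP/(_ y (set22 _ _)) := partitionS Ppart Py.
  rewrite remainingE !inE (negbTE yj) (negbTE yk) /= => /orP[yst|ky].
    case/negP: (Pst _ Py); apply/subsetP => z /set2P[] ->; rewrite !inE ?eqxx //.
    by rewrite yst orbT.
  by have := ncP x j k y xj jk ky Pxk; rewrite Py.
case: eqVneq => [ijk|ijk]; last first.
  rewrite mul0n; apply/eqP; rewrite cards_eq0; apply/eqP/setP => P.
  rewrite in_set0; apply/negP => cP; move: (closeE P cP) => Pjk.
  move: cP; rewrite !inE => /andP[/and5P[_ _ _ /respectsP rP _] _].
  by rewrite (rP _ _ Pjk) eqxx in ijk.
have notB P : P \in stack_pairings st k.+1 -> [set j; k] \notin P.
  rewrite inE => /and5P[Ppart _ _ _ _]; apply/negP => /(partitionS Ppart).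
  by move/subsetP/(_ k (set22 _ _)); rewrite !inE (negbTE kst) ltnn.
rewrite mul1n; pose f P := [set j; k] |: P.
have f_inj : {in stack_pairings st k.+1 &, injective f}.
  move=> P Q /notB PB /notB QB fPQ.
  by rewrite -(setU1K PB) -(setU1K QB) -/(f P) -/(f Q) fPQ.
rewrite -(card_in_imset f_inj); congr #|pred_of_set _|; apply/setP => P.
apply/idP/imsetP => [cP|[Q sQ ->{P}]].
  have Pjk := closeE P cP; exists (P :\ [set j; k]); last by rewrite /f setD1K.
  move: cP; rewrite !inE.
  case/andP=> /and5P[Ppart /forall_inP P2 /noncrossingP ncP /respectsP rP].
  move=> /forall_inP Pst _; apply/and5P; split.
  - have := partitionD1 Ppart Pjk; congr (partition _ _).
    rewrite remainingE setDUl setDv set0U; apply/setDidPl.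
    by rewrite disjoint_sym.
  - by apply/forall_inP => B /setD1P[_ /P2].
  - apply/noncrossingP => p q s t pq qs s_t /setD1P[_ Pps].
    by apply: contra (ncP _ _ _ _ pq qs s_t Pps) => /setD1P[].
  - by apply/respectsP => p q /setD1P[_ /rP].
  - apply/forall_inP => B /setD1P[_ /Pst]; apply: contra => /subsetP sub.
    by apply/subsetP => x /sub; rewrite inE => ->; rewrite orbT.
have QB := notB _ sQ.
move: sQ; rewrite !inE.
case/and5P=> Qpart /forall_inP Q2 /noncrossingP ncQ /respectsP rQ /forall_inP Qst.
(* No position of remaining st k.+1 lies in the interval from j to k. *)
have Qmem p q : [set p; q] \in Q ->
    ((p < j) || (k < p))%N && ((q < j) || (k < q))%N.
  move=> Qpq; have /subsetP sub := partitionS Qpart Qpq.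
  have := sub _ (set21 p q); have := sub _ (set22 p q); rewrite !inE.
  by case/orP=> [/st_j /= ->|->]; case/orP=> [/st_j /= ->|->]; rewrite ?orbT.
have set2_jk p q : [set p; q] = [set j; k] -> p = j /\ q = k \/ p = k /\ q = j.
  move=> e; have := set21 p q; have := set22 p q; rewrite e.
  have := set21 j k; have := set22 j k; rewrite -e !inE.
  by do 4!case/orP=> /eqP ?; subst; auto; rewrite eqxx in njk.
apply/andP; split; last first.
  by apply/exists_inP; exists j; rewrite !inE eqxx.
apply/and5P; split.
- rewrite remainingE; apply: partitionU1 => //.
  by apply/set0Pn; exists j; rewrite set21.
- apply/forall_inP => B /setU1P[->|/Q2 //]; by rewrite cards2 njk.
- apply/noncrossingP => p q s t pq qs s_t fps; apply/negP => fqt.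
  case/setU1P: fps => [/set2_jk e|Qps]; case/setU1P: fqt => [/set2_jk e'|Qqt].
  + by case: e => -[? ?]; case: e' => -[? ?]; subst; lia.
  + by have := Qmem _ _ Qqt; case: e => -[? ?]; subst; lia.
  + by have := Qmem _ _ Qps; case: e' => -[? ?]; subst; lia.
  + by case/negP: (ncQ _ _ _ _ pq qs s_t Qps).
- apply/respectsP => p q /setU1P[/set2_jk[][-> ->] //|/rQ //].
- apply/forall_inP => B /setU1P[->|QB'].
    apply/negP => /subsetP/(_ k (set22 _ _)); rewrite !inE eq_sym.
    by rewrite (negbTE njk) (negbTE kst).
  apply/negP => /subsetP sub; case/negP: (Qst _ QB'); apply/subsetP => x Bx.
  have := sub _ Bx; rewrite inE => /predU1P[xj|//]; subst x.
  have /subsetP/(_ _ Bx) := partitionS Qpart QB'.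
  by rewrite inE (negbTE jst) /=; lia.
Qed.

Lemma card_stack_pairings st k : (k <= m)%N -> path gtn k (map val st) ->
  #|stack_pairings st k| = stack_count (drop k i) [seq tnth i j | j <- st].
Proof.
(* Induction on the number m - k of positions left to read. *)
move=> le_km; rewrite -(subKn le_km).
move: (m - k)%N (leq_subr k m) => {k le_km} n; elim: n st => [|n IHn] st le_nm st_path.
  rewrite subn0 drop_oversize ?size_tuple //=.
  rewrite stack_pairings_end; first by case: (st).
  rewrite -(map_inj_uniq val_inj).
  exact: (sorted_uniq (rev_trans ltn_trans) ltnn (path_sorted st_path)).
have lt_km : (m - n.+1 < m)%N by lia.
pose k : 'I_m := Ordinal lt_km; have le_nm' := ltnW le_nm.
have kS : (m - n = k.+1)%N by rewrite /=; lia.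
have -> : drop (m - n.+1) i = tnth i k :: drop (m - n) i.
  have a0 := tnth i k.
  by rewrite kS (drop_nth a0) ?size_tuple // (tnth_nth a0).
rewrite -[(m - n.+1)%N]/(val k) in st_path *.
rewrite stack_pairings_split; last first.
  move: st_path; rewrite (path_sortedE (rev_trans ltn_trans)) all_map.
  by case/andP=> /allP.
have st_path' : path gtn k.+1 (map val (k :: st)) by rewrite /= ltnSn.
rewrite -kS IHn // ?kS //; congr (_ + _)%N.
case: st st_path {st_path'} => [_|j st st_path].
  apply/eqP; rewrite cards_eq0; apply/eqP/setP => P; rewrite in_set0.
  by apply/negP; rewrite inE => /andP[_ /exists_inP[]].
rewrite closing_pairings_cons //= -kS IHn // kS.
case/andP: st_path => /= jk; case: (st) => //= h st' /andP[/= hj st'P].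
by apply/andP; split => //=; lia.
Qed.

Lemma card_NC2 : #|NC2 i| = stack_count i [::].
Proof.
have := card_stack_pairings (st := [::]) (leq0n m) isT; rewrite drop0 => <-.
congr #|pred_of_set _|; apply/setP => P; rewrite !inE /pairing.
have -> : remaining [::] 0 = [set: 'I_m] by apply/setP => x; rewrite !inE leq0n.
rewrite -[LHS]andbA; have [Ppart /=|//] := boolP (partition P setT).
do 2!congr (_ && _); rewrite -[LHS]andbT; congr andb.
apply/esym/forall_inP => B PB; apply/negP => /subsetP sub.
by have /set0Pn[x /sub] := partition_neq0 Ppart PB.
Qed.

End StackPairings.

(** * The functional phi started from a stack *)

Section StackFunctionals.
Variables (K : comNzRingType) (r : nat).
Implicit Types (st : seq 'I_r) (a : 'I_r) (x : free_alg K r).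

Definition psi st x : K :=
  mmap idfun (fun w : {fmonom 'I_r} => (stack_count w st)%:R) x.

Lemma psi_linear st : scalar (psi st).
Proof.
move=> c x y; rewrite /psi mmapD; congr (_ + _).
rewrite (mmapEw (msuppZ_le c x)) mmapE mulr_sumr.
by apply: eq_bigr => w _; rewrite mcoeffZ mulrA.
Qed.

HB.instance Definition _ st :=
  GRing.isLinear.Build K (free_alg K r) K _ (psi st) (psi_linear st).

Lemma psi_nil x : psi [::] x = phi x.
Proof. by apply: eq_bigr => w _; rewrite card_NC2. Qed.

Lemma psi_monomial st (c : K) (w : {fmonom 'I_r}) :
  psi st << c *g w >> = c * (stack_count w st)%:R.
Proof. exact: mmapU. Qed.

Lemma psi1 st : psi st 1 = (nilp st)%:R.
Proof. by rewrite [LHS]psi_monomial mul1r fm1. Qed.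

Lemma psi_gen st a x :
  psi st (gen K a * x)
    = psi (a :: st) x
      + (if st is b :: st' then (b == a)%:R * psi st' x else 0).
Proof.
rewrite [x]monalgE mulr_sumr !raddf_sum /=.
have term w : psi st (gen K a * << x@_w *g w >>)
    = psi (a :: st) << x@_w *g w >>
      + (if st is b :: st' then (b == a)%:R * psi st' << x@_w *g w >> else 0).
  rewrite [gen K a * _]fgmulUU mul1r !psi_monomial fmM fmU /= natrD mulrDr.
  by case: st => [|b st'] /=; rewrite ?mulr0 // natrM psi_monomial mulrCA.
rewrite (eq_bigr _ (fun w _ => term w)) big_split /=; congr (_ + _).
case: st {term} => [|b st']; first by rewrite big1.
by rewrite raddf_sum mulr_sumr.
Qed.

(** Each further factor s_a of p(s_a) turns the stack a^n st into a^n.+1 st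
    plus, for n > 0, a^n.-1 st; for n = 0 the second term is absent because a
    is not on top of st.  So the coefficients do not depend on st or x.  They
    are kept as a list of pairs (coefficient, n), with repetitions allowed, so
    that both terms are obtained by mapping over the list. *)
Lemma psi_horner a (p : {poly K}) :
  exists cs : seq (K * nat), forall st x, ohead st != Some a ->
    psi st (horner_alg (gen K a) p * x)
      = \sum_(c <- cs) c.1 * psi (nseq c.2 a ++ st) x.
Proof.
elim/poly_ind: p => [|p d [cs IH]].
  by exists [::] => st x _; rewrite rmorph0 mul0r raddf0 big_nil.
exists ((d, 0%N) :: [seq (c.1, c.2.+1) | c <- cs]
                 ++ [seq (c.1, c.2.-1) | c <- cs & (0 < c.2)%N]) => st x st_a.
rewrite rmorphD rmorphM /= horner_algX horner_algC mulrDl -mulrA raddfD /= IH //.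
rewrite big_cons big_cat /= !big_map big_filter.
rewrite [LHS]addrC -scalerAl mul1r linearZ /=.
congr (_ + _).
rewrite [X in _ + X]big_mkcond -big_split /=; apply: eq_bigr => -[c [|n]] _ /=.
  rewrite psi_gen; case: st st_a => [|b st] /= st_a; first by rewrite !addr0.
  by rewrite (negbTE (st_a : b != a)) mul0r !addr0.
by rewrite psi_gen /= eqxx mul1r mulrDr.
Qed.

(** The start st is arbitrary because the induction on m consumes the first
    factor and pushes its letters; the stack or the product has to be non-empty
    as psi [::] 1 = 1. *)
Lemma psi_alternating (m : nat) (i : 'I_m -> 'I_r) (p : 'I_m -> {poly K}) st :
    (forall k l : 'I_m, l = k.+1 :> nat -> i k != i l) ->
    (forall k, phi (horner_alg (gen K (i k)) (p k)) = 0) ->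
    (forall k : 'I_m, k = 0%N :> nat -> ohead st != Some (i k)) ->
    (0 < m + size st)%N ->
  psi st (\prod_(k < m) horner_alg (gen K (i k)) (p k)) = 0.
Proof.
elim: m i p st => [|m IHm] i p st i_neq p0 st_i pos.
  by rewrite big_ord0 psi1; case: st pos {st_i}.
rewrite big_ord_recl; have [cs csE] := psi_horner (i ord0) (p ord0).
rewrite csE ?st_i //.
set x := \prod_(_ < _) _.
(* Reading p(s_a) from the empty stack isolates the coefficient of n = 0. *)
have cs0 : \sum_(c <- cs | c.2 == 0%N) c.1 = 0.
  rewrite -[RHS](p0 ord0) -psi_nil -[horner_alg _ _]mulr1 csE // big_mkcond.
  apply: eq_bigr => -[c [|n]] _ /=; first by rewrite psi1 mulr1.
  by rewrite psi1 mulr0.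
rewrite (bigID (fun c => c.2 == 0%N)) /= [X in _ + X]big1 ?addr0; last first.
  move=> [c [|n]] //= _; rewrite IHm ?mulr0 //.
  - by move=> k l lk; apply: i_neq; rewrite /= /bump /= lk.
  - move=> k k0; apply: i_neq.
    by rewrite /= /bump /= k0.
  - by rewrite addnS.
rewrite (eq_bigr (fun c => c.1 * psi st x)) -?mulr_suml ?cs0 ?mul0r //.
by case=> c n /= /eqP->.
Qed.

End StackFunctionals.

(** * Alternating products of centred polynomials *)

Theorem theorem12p7 (R : realType) (r m : nat) (i : m.-tuple 'I_r)
    (p : 'I_m -> {poly R[i]})
    (m_ge1 : (1 <= m)%N)
    (i_neq : forall k l : 'I_m, l = k.+1 :> nat -> tnth i k != tnth i l)
    (phi_p0 : forall k : 'I_m, phi (horner_alg (gen R[i] (tnth i k)) (p k)) = 0) :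
  phi (\prod_(k < m) horner_alg (gen R[i] (tnth i k)) (p k)) = 0.
Proof.
by rewrite -psi_nil psi_alternating // addn0.
Qed.
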